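(* Let $d\ge3$, and let $\Psi_{\mathrm C}^j$, $j\in\mathbb N_0$, be the polynomial curvelets defined in the context with $\kappa\in C^q([0,\infty))$ for some $q\in\mathbb N$. Assume that there exists some $t_0\in(1/2,2)$ such that $\kappa^{(q)}(t)\ne0$ for each $t\in(1/2,t_0)$. Then, for $j\in\mathbb N_0$, $$|\Psi_{\mathrm C}^j(x)|\le\frac{c_q\,2^{j(3d-2)/4}\,|x_d+\mathrm i x_{d-1}|^{2^{j-2}}}{(1+2^j|\operatorname{Arg}(x_d+\mathrm i x_{d-1})|)^q},\qquad x=(x_1,\dots,x_d)\in\mathbb S^{d-1}.$$ Here, $c_q>0$ is a constant which only depends on $\kappa$, $q$ and $d$.
   Context: $\mathbb S^{d-1}$ is the unit sphere of $\mathbb R^d$. For $z\in\mathbb C\setminus\{0\}$, $\operatorname{Arg}(z)\in(-\pi,\pi]$ is the principal argument, i.e. $z=|z|e^{\mathrm i\operatorname{Arg}(z)}$; no particular value of $\operatorname{Arg}(0)$ is fixed (it only occurs together with a vanishing factor $|z|^{2^{j-2}}$). Curvelets. Let $\phi\in C^q([0,\infty))$ be real-valued, non-increasing, with $\phi(t)=1$ for $t\in[0,1/2]$ and $\phi(t)=0$ for $t\ge1$. Put $\kappa(t)=\sqrt{\phi^2(t/2)-\phi^2(t)}$, so $\operatorname{supp}\kappa\subset[1/2,2]$. Let $\dim\mathcal H_n^d=\frac{(2n+d-2)(n+d-3)!}{(d-2)!\,n!}$ (the dimension of the space of spherical harmonics of degree $n$ on $\mathbb S^{d-1}$) and $$A_n=\frac{2^{(2-d)/2}}{\sqrt{\Gamma(d/2)}}\prod_{i=0}^{d-3}\sqrt{\frac{(2n+d-i-2)\,\Gamma(n+\frac{d-i-2}{2})}{\Gamma(n+\frac{d-i-1}{2})}},$$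 the positive constant such that $x\mapsto A_n(x_d+\mathrm i x_{d-1})^n$ has norm $1$ in $L^2(\mathbb S^{d-1})$ with respect to the rotation-invariant probability measure. The polynomial curvelets are $\Psi_{\mathrm C}^0\equiv1$ and, for $j\in\mathbb N$, $$\Psi_{\mathrm C}^j(x)=\sqrt2\sum_{n=0}^\infty\sqrt{\dim\mathcal H_n^d}\;\kappa\!\left(\tfrac{n}{2^{j-1}}\right)A_n\,\Re\{(x_d+\mathrm i x_{d-1})^n\},\qquad x\in\mathbb S^{d-1}.$$
   Formalization: The bound is stated for j ≥ 1 only: at j = 0 it is false, since the curvelet of index 0 is identically 1 while the right-hand side vanishes at points of the sphere with x_d + i x_{d-1} = 0, such as (1,0,…,0). *)

(* Defs.v *)
From mathcomp Require Import all_boot all_order all_algebra.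
From mathcomp Require Import all_classical all_reals all_analysis.
From mathcomp Require Export complex.

Set Implicit Arguments.
Unset Strict Implicit.
Unset Printing Implicit Defensive.

Import Order.TTheory GRing.Theory Num.Theory.
Import numFieldNormedType.Exports.

Local Open Scope classical_set_scope.
Local Open Scope complex_scope.
Local Open Scope ring_scope.

(* The modulus of z : R[i] as an element of R. *)
Notation cmod z := (ComplexField.Normc.normc z).

(* The class C^q([0,oo)): the derivatives of order at most q exist and are
   continuous on (0,oo) and extend continuously to 0. Only the values of f on
   [0,oo) matter, f being an arbitrary total function. *)
Definition Cq_halfline (R : realType) (q : nat) (f : R -> R) : Prop :=
  [/\ {within `[0, +oo[, continuous f},
      forall k t, (k < q)%N -> 0 < t -> derivable (derive1n k f) t 1,
      forall t, 0 < t -> {for t, continuous (derive1n q f)}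
    & forall k, (k <= q)%N -> cvg (derive1n k f t @[t --> 0^'+])].

Definition on_sphere (R : realType) (d : nat) (x : 'rV[R]_d) : Prop :=
  \sum_(i < d) x 0 i ^+ 2 = 1.

(* The entry of x with 0-based index k, and 0 when d <= k: the coordinates
   x_(d-1) and x_d of the usual 1-based numbering are coord x (d - 2) and
   coord x (d - 1). *)
Definition coord (R : realType) (d : nat) (x : 'rV[R]_d) (k : nat) : R :=
  if insub k is Some i then x 0 i else 0.

Definition zcoord (R : realType) (d : nat) (x : 'rV[R]_d) : R[i] :=
  coord x (d - 1) +i* coord x (d - 2).

(* For z = 0 every t in (-pi, pi] satisfies the equation, and the value of Arg
   is an unspecified one of them. *)
Definition Arg (R : realType) (z : R[i]) : R :=
  xget 0 [set t : R | - pi < t <= pi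
                      /\ z = (cmod z)%:C * (cos t +i* sin t)].

(* Meaningful for a > 0 only. *)
Definition Gamma (R : realType) (a : R) : R :=
  Rintegral (@lebesgue_measure R) `]0, +oo[
    (fun t => t `^ (a - 1) * expR (- t)).

(* The real dimension formula; the truncated subtractions are exact for
   3 <= d. *)
Definition dimH (R : realType) (d n : nat) : R :=
  ((2 * n + d - 2) * (n + d - 3)`!)%:R / ((d - 2)`! * n`!)%:R.

Definition Acoef (R : realType) (d n : nat) : R :=
  2 `^ ((2 - d%:R) / 2) / Num.sqrt (Gamma (d%:R / 2))
  * \prod_(i < d - 2)
      Num.sqrt ((2 * n + d - i - 2)%:R * Gamma (n%:R + (d - i - 2)%:R / 2)
                / Gamma (n%:R + (d - i - 1)%:R / 2)).

Definition kappa (R : realType) (phi : R -> R) (t : R) : R :=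
  Num.sqrt (phi (t / 2) ^+ 2 - phi t ^+ 2).

Definition curvelet (R : realType) (d : nat) (phi : R -> R) (j : nat)
    (x : 'rV[R]_d) : R :=
  if j is j'.+1 then
    Num.sqrt 2
    * limn (series (fun n => Num.sqrt (dimH R d n) * kappa phi (n%:R / 2 ^+ j')
                             * Acoef R d n * complex.Re (zcoord x ^+ n)))
  else 1.

(* The localization bound cannot include j = 0: the curvelet of index 0 is
   identically 1, whereas |z| `^ (2 `^ (-2)) vanishes at the points of the
   sphere with z = zcoord x = 0, which exist as soon as 3 <= d. *)
Lemma curvelet0_bound_false (R : realType) (d q : nat) (phi : R -> R) (c : R) :
  (3 <= d)%N ->
  ~ (forall x : 'rV[R]_d, on_sphere x ->
     `|curvelet phi 0 x| <=
     c * 2 `^ (0%:R * (3 * d%:R - 2) / 4)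
       * cmod (zcoord x) `^ (2 `^ (0%:R - 2))
     / (1 + 2 ^+ 0 * `|Arg (zcoord x)|) ^+ q).
Proof.
case: d => [//|d] hd H.
pose x : 'rV[R]_d.+1 := \row_(i < d.+1) (i == ord0)%:R.
have xS : on_sphere x.
  rewrite /on_sphere (bigD1 ord0) //= mxE eqxx expr1n.
  rewrite big1 ?addr0 // => i i0.
  by rewrite mxE (negbTE i0) expr0n.
have cx k : (0 < k)%N -> coord x k = 0.
  move=> k0; rewrite /coord; case: insubP => // i _ ik.
  by rewrite mxE -val_eqE /= ik -(prednK k0).
have zx : zcoord x = 0.
  rewrite /zcoord (cx (d.+1 - 1)%N) ?(cx (d.+1 - 2)%N) // subn_gt0 //.
  exact: ltnW.
have := H x xS.
rewrite zx ComplexField.Normc.normc0 powR0; last first.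
  by rewrite gt_eqF // powR_gt0.
by rewrite mulr0 mul0r normr1 ler10.
Qed.

(* Main.v *)
Require Import Defs.
From mathcomp Require Import all_boot all_order all_algebra.
From mathcomp Require Import all_classical all_reals all_analysis.
From mathcomp Require Import measurable_realfun ring lra zify.

(** Put z = x_d + i x_(d-1), N = 2^(j-1), b n = sqrt (dim H_n) * A_n and
    f n = b n * kappa (n / N). Up to the factor sqrt 2 the curvelet is the real
    part of P = sum_n f n z^n, a polynomial whose monomials satisfy
    N / 2 < n < 2 N.

    Summation by parts gives (1 - z)^k P = z^k sum_n (Delta^k f) n z^n as soon
    as k <= N / 2 [summation_by_parts], where Delta is the forward difference.
    A term on the right vanishes unless n + k > N / 2, so that each of the at
    most 2 N terms carries the factor |z|^(N / 2) = |z|^(2^(j-2)). Hence a bound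
    |Delta^k f| <= C N^(e - k) with e = 3 (d - 2) / 4 [fwd_window_le] yields
    |1 - z|^k |P| <= C N^(e + 1 - k) |z|^(N / 2) [window_poly_le], and
    e + 1 = (3 d - 2) / 4 is the exponent of the theorem. The case k = 0 bounds
    the size of P. The case k = q gives its decay, because
    |1 - z| >= |Arg z| / 8 on the closed unit disc [Arg_le_dist1]. When N < 2 q
    the quantity N |Arg z| is bounded and the case k = 0 is enough
    [window_poly_localized].

    The bound on Delta^k f comes from the Leibniz rule. The differences of
    n |-> kappa (n / N) are controlled by the bounded derivatives of kappa
    through the mean value theorem. For b no derivative of Gamma is computed:
    the functional equation Gamma (s + 1) = s Gamma s [GammaS] makes
    b (n+1) / b n a product of square roots of factors 1 + e_i / (n + c_i).
    So b (n+1) = (1 + s n) b n, where s has the differences of a symbol of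
    order -1 and s n = e / (n+1) + O(1 / (n+1)^2). The first property gives
    Delta^k b = t_k b with t_k of order -k [growth_fwd], the second gives
    b n = O((n+1)^e) [growth_le]. *)

Set Implicit Arguments.
Unset Strict Implicit.
Unset Printing Implicit Defensive.

Import Order.TTheory GRing.Theory Num.Theory.
Import numFieldNormedType.Exports.

Local Open Scope classical_set_scope.
Local Open Scope ring_scope.

(** * The functional equation of the Gamma function *)

Lemma powR_expRN_cvg0 (R : realType) (s : R) :
  n.+1%:R `^ s * expR (- n.+1%:R) @[n --> \oo] --> (0 : R).
Proof.
have [k sk] : exists k : nat, s <= k%:R.
  by exists (Num.truncn `|s|).+1; rewrite (le_trans (ler_norm _)) // ltW // truncnS_gt.
apply: (@squeeze_cvgr _ _ _ _ (fun=> 0) (fun n => (k.+1)`!%:R * harmonic n)).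
- near=> n.
  rewrite mulr_ge0 ?powR_ge0 ?expR_ge0 //=.
  have n0 : 0 < n.+1%:R :> R by [].
  rewrite expRN ler_pdivrMr ?expR_gt0 //.
  have h := expR_ge1Dxn k (ltW n0).
  have {}h : n.+1%:R ^+ k.+1 / k.+1`!%:R <= expR n.+1%:R :> R.
    by rewrite (le_trans _ h) // lerDr.
  rewrite ler_pdivrMr ?ltr0n ?fact_gt0 // in h.
  apply: (@le_trans _ _ (n.+1%:R ^+ k)).
    by rewrite -powR_mulrn // ler_powR // ler1n.
  rewrite mulrAC ler_pdivlMr // -exprSr (le_trans h) // mulrC //.
- exact: cvg_cst.
- rewrite -[X in _ --> X](mulr0 (k.+1`!%:R)).
  by apply: cvgM; [exact: cvg_cst | exact: cvg_harmonic].
Unshelve. all: by end_near. Qed.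

Lemma powR_expRN_derive (R : realType) (s t : R) : 0 < t ->
  is_derive t 1 (fun t => t `^ s * expR (- t))
    (s * (t `^ (s - 1) * expR (- t)) - t `^ s * expR (- t)).
Proof.
move=> t0.
have d1 : is_derive t 1 (fun t : R => expR (- t)) (- expR (- t)).
  by apply: is_derive_eq; rewrite mulrN1.
have := is_deriveM (is_derive1_powR s t0) d1.
move/is_derive_eq; apply.
rewrite /GRing.scale /=; ring.
Qed.

(** The derivative of f t = t^s exp (- t) is g - f, where g and f are the
    integrands of s Gamma s and Gamma (s + 1). The fundamental theorem of
    calculus on the segments D n = [1 / (n+1), n+1], which avoid the possible
    singularity at 0, shows that the two integrals over D n differ by boundary
    values that tend to 0; monotone convergence then identifies the integrals
    over (0, oo) as extended reals. An infinite common value is harmless,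
    since fine maps oo to 0. *)
Lemma GammaS (R : realType) (s : R) : 0 < s -> Gamma (s + 1) = s * Gamma s.
Proof.
move=> s0.
pose D n : set R := `[n.+1%:R^-1, n.+1%:R]%classic.
have UD : \bigcup_n D n = `]0, +oo[%classic.
  apply/seteqP; split=> x.
    move=> [n _]; rewrite /D /= !in_itv /= andbT => /andP[h _].
    by apply: lt_le_trans h; rewrite invr_gt0.
  rewrite /= in_itv /= andbT => x0.
  exists (Num.truncn (x + x^-1)) => //; rewrite /D /= in_itv /=.
  have xi : 0 < x^-1 by rewrite invr_gt0.
  have h := ltW (truncnS_gt (x + x^-1)).
  apply/andP; split.
    by rewrite -[leRHS]invrK lef_pV2 ?posrE // (le_trans _ h) // lerDr ltW.
  by rewrite (le_trans _ h) // lerDl ltW.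
have Dgt0 n t : D n t -> 0 < t.
  rewrite /D /= in_itv /= => /andP[h _].
  by apply: lt_le_trans h; rewrite invr_gt0.
have cD (f : R -> R) n : (forall t, 0 < t -> {for t, continuous f}) ->
    {within D n, continuous f}.
  move=> cf; apply: continuous_in_subspaceT => x; rewrite inE => /Dgt0; exact: cf.
have iD (f : R -> R) n : (forall t, 0 < t -> {for t, continuous f}) ->
    lebesgue_measure.-integrable (D n) (EFin \o f).
  move=> cf; apply: continuous_compact_integrable; first exact: segment_compact.
  exact: cD.
have mpos (f : R -> R) : (forall t, 0 < t -> {for t, continuous f}) ->
    measurable_fun `](0 : R), +oo[ f.
  move=> cf; apply: open_continuous_measurable_fun => //.
  by move=> x; rewrite inE /= in_itv /= andbT; exact: cf.
have cvD (f : R -> R) : (forall t, 0 < t -> 0 <= f t) ->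
    (forall t, 0 < t -> {for t, continuous f}) ->
    (\int[lebesgue_measure]_(x in D n) (f x)%:E @[n --> \oo] --> \int[lebesgue_measure]_(x in `]0%R, +oo[) (f x)%:E)%E.
  move=> f0 cf; rewrite -UD; apply: ge0_nondecreasing_set_cvg_integral.
  - move=> m n mn; rewrite subsetEset => x; rewrite /D /= !in_itv /= => /andP[h1 h2].
    apply/andP; split.
      by apply: le_trans h1; rewrite lef_pV2 ?posrE // ler_nat.
    by apply: (le_trans h2); rewrite ler_nat.
  - by move=> n; exact: measurable_itv.
  - by move=> n; apply: (measurable_int lebesgue_measure); exact: iD.
  - by move=> n x /Dgt0 x0; rewrite lee_fin f0.
pose f t : R := t `^ s * expR (- t).
pose h t : R := t `^ (s - 1) * expR (- t).
pose g t : R := s * h t.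
have cf t : 0 < t -> {for t, continuous f}.
  move=> t0; apply: differentiable_continuous; apply/derivable1_diffP.
  by have [] := powR_expRN_derive s t0.
have ch t : 0 < t -> {for t, continuous h}.
  move=> t0; apply: differentiable_continuous; apply/derivable1_diffP.
  by have [] := powR_expRN_derive (s - 1) t0.
have cg t : 0 < t -> {for t, continuous g}.
  by move=> t0; apply: continuousM; [exact: cst_continuous | exact: ch].
have f0 t : 0 <= f t by rewrite /f mulr_ge0 ?powR_ge0 ?expR_ge0.
have h0 t : 0 <= h t by rewrite /h mulr_ge0 ?powR_ge0 ?expR_ge0.
have g0 t : 0 <= g t by rewrite /g mulr_ge0 // ltW.
have key n : (\int[lebesgue_measure]_(x in D n.+1) (g x)%:E =
    \int[lebesgue_measure]_(x in D n.+1) (f x)%:E + (f n.+2%:R - f n.+2%:R^-1)%:E)%E.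
  have n1 : n.+2%:R^-1 < n.+2%:R :> R.
    apply: (@lt_trans _ _ 1); last by rewrite ltr1n.
    by rewrite invf_lt1 // ltr1n.
  have e : (\int[lebesgue_measure]_(x in D n.+1) (g x - f x)%:E = (f n.+2%:R)%:E - (f n.+2%:R^-1)%:E)%E.
    apply: (@continuous_FTC2 _ (g \- f) f) => //.
    - by apply: cD => t t0; apply: continuousB; [exact: cg | exact: cf].
    - split.
      + move=> t /[dup] ht; rewrite in_itv /= => /andP[t0 _].
        have {}t0 : 0 < t by apply: lt_trans t0; rewrite invr_gt0.
        by have [] := powR_expRN_derive s t0.
      + by apply: cvg_at_right_filter; apply: cf; rewrite invr_gt0.
      + by apply: cvg_at_left_filter; apply: cf.
    - move=> t; rewrite in_itv /= => /andP[t0 _].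
      have {}t0 : 0 < t by apply: lt_trans t0; rewrite invr_gt0.
      by rewrite derive1E; have [_ ->] := powR_expRN_derive s t0.
  have i1 : lebesgue_measure.-integrable (D n.+1) (EFin \o g) by exact: iD.
  have i2 : lebesgue_measure.-integrable (D n.+1) (EFin \o f) by exact: iD.
  move: e; under eq_integral do rewrite EFinB.
  rewrite (integralB_EFin _ i1 i2); last exact: measurable_itv.
  rewrite EFinB => <-.
  rewrite addeC subeK //.
  have := @integrable_fin_num _ _ _ _ _ _ _ i2; apply; exact: measurable_itv.
have fn0 : (f n.+2%:R - f n.+2%:R^-1) @[n --> \oo] --> (0 : R).
  rewrite -[X in _ --> X](subrr 0); apply: cvgB.
    by have := powR_expRN_cvg0 s; rewrite -(cvg_shiftS _) ; exact.
  apply: (@squeeze_cvgr _ _ _ _ (fun=> 0) (fun n => n.+2%:R^-1 `^ s)).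
  - near=> n; rewrite f0 /f /=; rewrite ger_pMr ?powR_gt0 ?invr_gt0 //.
  - exact: cvg_cst.
  - have /cvg_at_rightP := powR_cvg0 s0.
    apply; split; first by move=> n; rewrite invr_gt0.
    by have := @cvg_harmonic R; rewrite -(cvg_shiftS _); exact.
have E : (\int[lebesgue_measure]_(x in `]0%R, +oo[) (g x)%:E = \int[lebesgue_measure]_(x in `]0%R, +oo[) (f x)%:E)%E.
  have c1 := cvD _ (fun t _ => g0 t) cg.
  have c2 := cvD _ (fun t _ => f0 t) cf.
  rewrite -(cvg_shiftS _) in c1; rewrite -(cvg_shiftS _) in c2.
  apply: (cvg_unique _ c1) => //.
  rewrite (_ : [sequence _]_n = fun n => (\int[lebesgue_measure]_(x in D n.+1) (f x)%:E +
      (f n.+2%:R - f n.+2%:R^-1)%:E)%E); last by apply/funext => n; exact: key.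
  rewrite /= -[X in _ --> X]adde0; apply: cvgeD => //.
  - by rewrite fin_num_adde_defl.
  - by apply: cvg_EFin; [near=> n | exact: fn0].
have Eg : (\int[lebesgue_measure]_(x in `]0%R, +oo[) (g x)%:E =
    s%:E * \int[lebesgue_measure]_(x in `]0%R, +oo[) (h x)%:E)%E.
  rewrite -ge0_integralZl_EFin //.
  - by move=> x _; rewrite lee_fin.
  - by apply/measurable_EFinP; exact: mpos.
  - exact: ltW.
rewrite /Gamma /Rintegral addrK.
rewrite -[X in fine X]E Eg.
by case: (\int[_]_(_ in _) _)%E => [r| |] //=; rewrite ?mulr0 // ?(gt0_muley, gt0_muleNy) ?lte_fin //= mulr0.
Unshelve. all: by end_near. Qed.

(** * Finite differences of symbols, and sequences of power growth *)

Section Symbols.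
Context {R : realType}.
Implicit Types (a b s t u : nat -> R) (K p : nat) (c e : R).

Definition fwd a n := a n.+1 - a n.

(** The weight is n+1 rather than n, so that the bound says something at
    n = 0 as well. *)
Definition decay p a := exists C : R, forall n, `|a n| * n.+1%:R ^+ p <= C.

(** Discrete symbols of order - p: each difference gains one power of n.
    The number K of controlled differences is a parameter because the closure
    under inverse and square root is proved by induction on it. *)
Fixpoint symb K p a : Prop :=
  decay p a /\ if K is K'.+1 then symb K' p.+1 (fwd a) else True.

Lemma decayD p a b : decay p a -> decay p b -> decay p (fun n => a n + b n).
Proof.
move=> [C aC] [D bD]; exists (C + D) => n.
by rewrite (le_trans _ (lerD (aC n) (bD n))) // -mulrDl ler_wpM2r // ler_normD.
Qed.

Lemma decayM p p' a b :
  decay p a -> decay p' b -> decay (p + p') (fun n => a n * b n).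
Proof.
move=> [C aC] [D bD]; exists (C * D) => n.
by rewrite normrM exprD mulrACA ler_pM // mulr_ge0.
Qed.

Lemma decayW p p' a : (p <= p')%N -> decay p' a -> decay p a.
Proof.
move=> pp' [C aC]; exists C => n.
by rewrite (le_trans _ (aC n)) // ler_wpM2l // ler_weXn2l // ler1n.
Qed.

Lemma decayS p a : decay p a -> decay p (fun n => a n.+1).
Proof.
move=> [C aC]; exists C => n.
by rewrite (le_trans _ (aC n.+1)) // ler_wpM2l // lerXn2r ?nnegrE // ler_nat.
Qed.

Lemma symb_decay K p a : symb K p a -> decay p a.
Proof. by case: K => [|K] []. Qed.

Lemma symb_pred K p a : symb K.+1 p a -> symb K p a.
Proof. by elim: K p a => [|K IH] p a [da sa]; split=> //; exact: IH. Qed.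

Lemma symb_lower K p a : symb K p.+1 a -> symb K p a.
Proof.
elim: K p a => [|K IH] p a [da sa]; split=> //; try exact: decayW da.
exact: IH.
Qed.

Lemma symbD K p a b : symb K p a -> symb K p b -> symb K p (fun n => a n + b n).
Proof.
elim: K p a b => [|K IH] p a b [da sa] [db sb]; split=> //; try exact: decayD.
rewrite (_ : fwd _ = fun n => fwd a n + fwd b n); first exact: IH.
by apply/funext => n; rewrite /fwd; ring.
Qed.

Lemma symb_shift K p a : symb K p a -> symb K p (fun n => a n.+1).
Proof.
elim: K p a => [|K IH] p a [da sa]; split=> //; try exact: decayS.
by apply: (IH _ (fwd a)).
Qed.

Lemma symbM K p p' a b :
  symb K p a -> symb K p' b -> symb K (p + p') (fun n => a n * b n).
Proof.
elim: K p p' a b => [|K IH] p p' a b sa sb; split=> //;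
  try by apply: decayM; [exact: symb_decay sa | exact: symb_decay sb].
rewrite (_ : fwd _ = fun n => fwd a n * b n.+1 + a n * fwd b n); last first.
  by apply/funext => n; rewrite /fwd; ring.
have [da sa'] := sa; have [db sb'] := sb.
apply: symbD.
  by rewrite -addSn; apply: IH => //; apply: symb_shift; exact: symb_pred.
by rewrite -addnS; apply: IH => //; exact: symb_pred.
Qed.

Lemma symb0 K p : symb K p (fun=> 0).
Proof.
have d0 q : decay q (fun=> 0) by exists 0 => n; rewrite normr0 mul0r.
elim: K p => [|K IH] p; split=> //.
rewrite (_ : fwd _ = fun=> 0) //.
by apply/funext => n; rewrite /fwd subrr.
Qed.

Lemma symb_cst K c : symb K 0 (fun=> c).
Proof.
have dc : decay 0 (fun=> c) by exists `|c| => n; rewrite mulr1.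
case: K => [|K]; split=> //.
rewrite (_ : fwd _ = fun=> 0); first exact: symb0.
by apply/funext => n; rewrite /fwd subrr.
Qed.

Lemma symbZ K p c a : symb K p a -> symb K p (fun n => c * a n).
Proof. by move=> sa; apply: (@symbM K 0 p) => //; exact: symb_cst. Qed.

(** The difference of 1 / a is - Delta a / (a n * a (n+1)): one difference of a
    times inverses whose differences are controlled one order less. *)
Lemma symbV K c a : 0 < c -> (forall n, c <= a n) ->
  symb K 0 a -> symb K 0 (fun n => (a n)^-1).
Proof.
move=> c0 ca; have a0 n : 0 < a n by exact: lt_le_trans (ca n).
have d : decay 0 (fun n => (a n)^-1).
  exists c^-1 => n; rewrite mulr1 ger0_norm ?invr_ge0 ?(ltW (a0 n)) //.
  by rewrite lef_pV2 ?posrE.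
elim: K => [|K IH] sa; split=> //.
rewrite (_ : fwd _ = fun n => fwd a n * ((a n)^-1 * ((-1) * (a n.+1)^-1))).
  have si := IH (symb_pred sa).
  apply: (@symbM K 1 0); first by case: sa.
  apply: (@symbM K 0 0) => //; apply: symbZ.
  exact: (@symb_shift K 0 (fun n => (a n)^-1)).
by apply/funext => n; rewrite /fwd; field; rewrite !gt_eqF.
Qed.

(** The difference of sqrt a is Delta a / (sqrt (a n) + sqrt (a (n+1))), and
    its denominator is bounded below and controlled one order less. *)
Lemma symb_sqrt K c a : 0 < c -> (forall n, c <= a n) ->
  symb K 0 a -> symb K 0 (fun n => Num.sqrt (a n)).
Proof.
move=> c0 ca; have a0 n : 0 < a n by exact: lt_le_trans (ca n).
have u0 n : Num.sqrt c <= Num.sqrt (a n) by rewrite ler_sqrt // ltW.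
have sc0 : 0 < Num.sqrt c by rewrite sqrtr_gt0.
elim: K => [|K IH] sa.
  split=> //; have [C aC] := symb_decay sa; exists (1 + C) => n.
  rewrite mulr1 ger0_norm ?sqrtr_ge0 //.
  have := aC n; rewrite mulr1 (ger0_norm (ltW (a0 n))).
  rewrite -[X in X <= C](sqr_sqrtr (ltW (a0 n))) => h.
  by have := sqr_ge0 (Num.sqrt (a n) - 1); nra.
have su := IH (symb_pred sa).
split; first exact: symb_decay su.
rewrite (_ : fwd _ = fun n => fwd a n * (Num.sqrt (a n) + Num.sqrt (a n.+1))^-1).
  apply: (@symbM K 1 0); first by case: sa.
  apply: (@symbV K (Num.sqrt c)) => //.
    by move=> n; rewrite (le_trans (u0 n)) // lerDl sqrtr_ge0.
  by apply: symbD => //; exact: (@symb_shift K 0 (fun n => Num.sqrt (a n))).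
apply/funext => n; rewrite /fwd.
have h m : Num.sqrt (a m) > 0 by rewrite sqrtr_gt0.
have -> : a n.+1 - a n = Num.sqrt (a n.+1) ^+ 2 - Num.sqrt (a n) ^+ 2.
  by rewrite !sqr_sqrtr // ltW.
by field; rewrite gt_eqF // addr_gt0.
Qed.

Lemma symb_shifted_inv K c : 0 < c -> symb K 1 (fun n => (n%:R + c)^-1).
Proof.
move=> c0; elim: K c c0 => [|K IH] c c0.
  split=> //; exists (1 + c^-1) => n.
  have nc : 0 < n%:R + c by rewrite ltr_wpDl.
  rewrite expr1 ger0_norm ?invr_ge0 ?(ltW nc) // mulrC ler_pdivrMr // mulrDl mul1r.
  rewrite mulrDr mulVf ?gt_eqF // -natr1.
  have : 0 <= c^-1 * n%:R by rewrite mulr_ge0 // invr_ge0 ltW.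
  by move: (ltW c0); lra.
have dc := symb_decay (IH c c0).
split=> //.
rewrite (_ : fwd _ = fun n => (-1) * ((n%:R + c)^-1 * (n%:R + (c + 1))^-1)).
  by apply: symbZ; apply: (@symbM K 1 1); apply: IH; rewrite ?addr_gt0.
apply/funext => n; rewrite /fwd -natr1.
have nc : 0 < n%:R + c by rewrite ltr_wpDl.
have n1c : 0 < n%:R + 1 + c by rewrite addrAC addr_gt0.
by rewrite [n%:R + (_ + _)]addrA (addrAC _ c 1); field; rewrite !gt_eqF.
Qed.

(** Sequences that behave like C (n+1)^e, described by their successive
    ratios 1 + s n. This form makes the class stable under products and square
    roots, and it applies to quotients of Gamma values without any asymptotic
    expansion. *)
Definition growth e b := exists s : nat -> R,
  [/\ forall n, b n.+1 = (1 + s n) * b n,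
      forall K, symb K 1 s,
      decay 2 (fun n => s n - e / n.+1%:R)
    & exists2 c, 0 < c & forall n, c <= 1 + s n].

Lemma decay_inv1 : decay 1 (fun n => n.+1%:R^-1).
Proof.
by exists 1 => n; rewrite expr1 ger0_norm ?invr_ge0 // mulVf.
Qed.

Lemma growthM e e' b b' : growth e b -> growth e' b' ->
  growth (e + e') (fun n => b n * b' n).
Proof.
move=> [s [bs ss ds [c c0 cs]]] [t [bt st dt [d d0 dtt]]].
exists (fun n => s n + t n + s n * t n); split.
- by move=> n; rewrite bs bt; ring.
- move=> K; apply: symbD; first exact: symbD.
  by apply: symb_lower; apply: (@symbM K 1 1).
- rewrite (_ : (fun _ => _) = fun n => (s n - e / n.+1%:R + (t n - e' / n.+1%:R)) + s n * t n).
    apply: decayD; first exact: decayD.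
    by apply: (@decayM 1 1); [exact: symb_decay (ss 0%N) | exact: symb_decay (st 0%N)].
  by apply/funext => n; ring.
- exists (c * d); first exact: mulr_gt0.
  move=> n; rewrite (_ : 1 + _ = (1 + s n) * (1 + t n)); last by ring.
  by rewrite ler_pM // ltW.
Qed.

(** With u = sqrt (1 + s) the new ratio is 1 + (u - 1). The identities
    u - 1 = s / (1 + u) and u - 1 = s / 2 - (u - 1)^2 / 2 give respectively the
    symbol property and the expansion to second order. *)
Lemma growth_sqrt e b : growth e b -> growth (e / 2) (fun n => Num.sqrt (b n)).
Proof.
move=> [s [bs ss ds [c c0 cs]]].
pose u n := Num.sqrt (1 + s n).
have s0 n : 0 < 1 + s n by exact: lt_le_trans (cs n).
have u2 n : u n ^+ 2 = 1 + s n by rewrite sqr_sqrtr // ltW.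
have u0 n : 0 < u n by rewrite sqrtr_gt0.
have su K : symb K 1 (fun n => u n - 1).
  rewrite (_ : (fun _ => _) = fun n => s n * (1 + u n)^-1).
    apply: (@symbM K 1 0) => //; apply: (@symbV K 1) => //.
      by move=> n; rewrite lerDl ltW.
    apply: symbD; first exact: symb_cst.
    apply: (symb_sqrt c0) => //; apply: symbD; first exact: symb_cst.
    exact: symb_lower.
  apply/funext => n; have -> : s n = u n ^+ 2 - 1 by rewrite u2; ring.
  by field; rewrite gt_eqF // addr_gt0.
exists (fun n => u n - 1); split => //.
- move=> n; rewrite bs sqrtrM ?(ltW (s0 _)) //; congr (_ * _).
  by rewrite /u; ring.
- rewrite (_ : (fun _ => _) = fun n => 2^-1 * (s n - e / n.+1%:R) + (- 2^-1) * ((u n - 1) * (u n - 1))).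
    have dk k : decay 0 (fun=> k : R) := symb_decay (symb_cst 0 k).
    apply: decayD; first exact: (decayM (dk _) ds).
    have du := symb_decay (su 0%N).
    exact: (decayM (dk _) (decayM du du)).
  apply/funext => n; have -> : s n = u n ^+ 2 - 1 by rewrite u2; ring.
  by field.
- exists (Num.sqrt c); first by rewrite sqrtr_gt0.
  by move=> n; rewrite addrC subrK ler_sqrt // ltW.
Qed.

Lemma growth_linear e c b : 0 < c -> 0 < c + e ->
  (forall n, b n.+1 = (1 + e / (n%:R + c)) * b n) -> growth e b.
Proof.
move=> c0 ce be; exists (fun n => e * (n%:R + c)^-1).
have nc n : 0 < n%:R + c by rewrite ltr_wpDl.
have ss K : symb K 1 (fun n => e * (n%:R + c)^-1).
  by apply: symbZ; exact: symb_shifted_inv.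
split=> //.
- rewrite (_ : (fun _ => _) = fun n => (e * (n%:R + c)^-1) * ((1 - c) * n.+1%:R^-1)).
    apply: (@decayM 1 1); first exact: symb_decay (ss 0%N).
    apply: (@decayM 0 1); last exact: decay_inv1.
    exact: symb_decay (symb_cst 0 _).
  apply/funext => n; rewrite -natr1; field.
  by rewrite natr1 !gt_eqF.
- have [e0|e0] := leP 0 e.
    by exists 1 => // n; rewrite lerDl divr_ge0 // ltW.
  exists (1 + e / c).
    by rewrite -(pmulr_lgt0 _ c0) mulrDl mul1r divfK ?gt_eqF.
  move=> n; rewrite lerD2l ler_wnM2l ?(ltW e0) // lef_pV2 ?posrE //.
  by rewrite lerDr.
Qed.

Lemma growth_const c : growth 0 (fun=> c).
Proof.
by apply: (@growth_linear 0 1); rewrite ?addr0 // => n; rewrite mul0r addr0 mul1r.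
Qed.

Lemma growth_prod m e (F : nat -> nat -> R) : (forall i, (i < m)%N -> growth e (F i)) ->
  growth (m%:R * e) (fun n => \prod_(i < m) F i n).
Proof.
elim: m => [|m IH] h.
  rewrite mul0r (_ : (fun _ => _) = fun=> 1); first exact: growth_const.
  by apply/funext => n; rewrite big_ord0.
rewrite -natr1 mulrDl mul1r.
rewrite (_ : (fun _ => _) = fun n => \prod_(i < m) F i n * F m n).
  by apply: growthM; [apply: IH => i im; apply: h; exact: ltnW | exact: h].
by apply/funext => n; rewrite big_ord_recr.
Qed.

(** Since exp (e * ln ((n+2) / (n+1))) is the ratio of the powers and
    ln ((n+2) / (n+1)) >= 1 / (n+2), the ratio of b exceeds it by a factor
    exp (O(1 / (n+1)^2)). These factors have a bounded product; the induction
    carries it as exp (M - M / (n+1)). *)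
Lemma growth_le e b : 0 <= e -> growth e b ->
  exists2 C, 0 <= C & forall n, `|b n| <= C * n.+1%:R `^ e.
Proof.
move=> e0 [s [bs ss [D ds] [c c0 cs]]].
have D0 : 0 <= D by apply: le_trans (ds 0%N); rewrite mulr_ge0.
have [M ME] : exists M, M = 2 * (D + e) by exists (2 * (D + e)).
have M0 : 0 <= M by rewrite ME mulr_ge0 // addr_ge0.
exists (`|b 0%N| * expR M); first by rewrite mulr_ge0 // expR_ge0.
suff H n : `|b n| <= `|b 0%N| * expR (M - M / n.+1%:R) * n.+1%:R `^ e.
  move=> n; apply: (le_trans (H n)); rewrite ler_wpM2r ?powR_ge0 //.
  by rewrite ler_wpM2l // ler_expR gerBl divr_ge0.
elim: n => [|n IH].
  by rewrite divr1 subrr expR0 powR1 !mulr1.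
have n0 : 0 < n.+1%:R :> R by [].
have n1 : 0 < n.+2%:R :> R by [].
rewrite bs normrM ger0_norm; last by rewrite (le_trans _ (cs n)) // ltW.
have h1 : 1 + s n <= expR (e / n.+1%:R + D / n.+1%:R ^+ 2).
  apply: le_trans (expR_ge1Dx _); rewrite lerD2l -lerBlDl.
  by rewrite ler_pdivlMr ?exprn_gt0 // (le_trans _ (ds n)) // ler_wpM2r ?exprn_ge0 // ler_norm.
have h2 : n.+2%:R `^ e = n.+1%:R `^ e * expR (e * ln (n.+2%:R / n.+1%:R)) :> R.
  rewrite /powR !gt_eqF // ln_div ?posrE // -expRD; congr expR; ring.
have h3 : n.+2%:R^-1 <= ln (n.+2%:R / n.+1%:R) :> R.
  rewrite -[X in ln X]invf_div lnV ?posrE ?divr_gt0 // lerNr.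
  have y0 : 0 < n.+1%:R / n.+2%:R :> R by rewrite divr_gt0.
  have -> : n.+1%:R / n.+2%:R = 1 + (- n.+2%:R^-1) :> R.
    by rewrite -[X in X / _](addrK 1) natr1 mulrBl divff ?gt_eqF // mul1r.
  apply: le_ln1Dx.
  by rewrite ltrN2 invf_lt1 // ltr1n.
rewrite (le_trans (ler_pM _ _ h1 IH)) //; first by rewrite (le_trans _ (cs n)) // ltW.
rewrite h2 [leLHS]mulrC -!mulrA ler_wpM2l //.
rewrite [leLHS]mulrCA [leRHS]mulrCA ler_wpM2l ?powR_ge0 // -!expRD ler_expR.
pose A : R := n.+1%:R^-1; pose B : R := n.+2%:R^-1.
have A0 : 0 <= A by rewrite invr_ge0.
have B0 : 0 <= B by rewrite invr_ge0.
have AB : A - B = A * B.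
  have inv (x : R) : 0 < x -> 0 < x + 1 -> x^-1 - (x + 1)^-1 = x^-1 * (x + 1)^-1.
    by move=> x0 x1; field; rewrite !gt_eqF.
  by have := inv n.+1%:R; rewrite natr1; apply.
have A2B : A <= 2 * B.
  have A1 : A <= 1 by rewrite invf_le1 // ler1n.
  have : A * B <= 1 * B by rewrite ler_wpM2r.
  by rewrite -AB; lra.
have eB : e * B <= e * ln (n.+2%:R / n.+1%:R) by rewrite ler_wpM2l.
rewrite -exprVn -/A -/B.
apply: (@le_trans _ _ (M - M * B + e * B)); last by rewrite lerD2l.
have h4 : D * (A * A) <= D * (A * (2 * B)) by rewrite ler_wpM2l // ler_wpM2l.
have h5 : 0 <= e * (A * B) by rewrite !mulr_ge0.
have : M * (A - B) = M * (A * B) by rewrite AB.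
have : e * (A - B) = e * (A * B) by rewrite AB.
rewrite ME; nra.
Qed.

(** The k-th difference of b is t * b for a symbol t of order - k: passing from
    k to k + 1 replaces t by Delta t + t (n+1) * s n. *)
Lemma growth_fwd e b k : growth e b ->
  exists2 C, 0 <= C & forall n, `|iter k fwd b n| * n.+1%:R ^+ k <= C * `|b n|.
Proof.
move=> [s [bs ss _ _]].
suff [t st tb] : exists2 t, forall K, symb K k t & forall n, iter k fwd b n = t n * b n.
  have [C tC] := symb_decay (st 0%N).
  exists C; first by rewrite (le_trans _ (tC 0%N)) // mulr_ge0.
  by move=> n; rewrite tb normrM mulrAC ler_wpM2r.
elim: k => [|k [t st tb]].
  by exists (fun=> 1) => [K|n]; [exact: symb_cst | rewrite mul1r].
exists (fun n => fwd t n + t n.+1 * s n) => [K|n].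
  apply: symbD; first by case: (st K.+1).
  by rewrite -addn1; apply: (@symbM K k 1) => //; exact: symb_shift.
by rewrite iterS /fwd !tb bs; ring.
Qed.

End Symbols.

(** * Growth of the curvelet coefficients *)

(** By the functional equation the successive ratio is
    (n + k/2) / (n + (k+1)/2) = 1 - (1/2) / (n + (k+1)/2). *)
Lemma growth_Gamma_ratio (R : realType) (k : nat) : (0 < k)%N ->
  growth (- 2^-1 : R)
    (fun n => Gamma (n%:R + k%:R / 2) / Gamma (n%:R + k.+1%:R / 2)).
Proof.
move=> k0; apply: (@growth_linear R _ (k.+1%:R / 2)).
- by rewrite divr_gt0.
- by rewrite -natr1 mulrDl mul1r addrK divr_gt0 // ltr0n.
move=> n.
have a0 : 0 < n%:R + k%:R / 2 :> R by rewrite ltr_wpDl // divr_gt0 // ltr0n.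
have b0 : 0 < n%:R + k.+1%:R / 2 :> R by rewrite ltr_wpDl // divr_gt0.
rewrite -natr1 ![n%:R + 1 + _]addrAC !GammaS // invfM.
rewrite mulrACA; congr (_ * _).
have -> : n%:R + k%:R / 2 = (n%:R + k.+1%:R / 2) - 2^-1 :> R.
  by rewrite -natr1; field.
by rewrite mulrBl divff ?gt_eqF // mulNr.
Qed.

(** Each of the d - 2 factors is the square root of a linear factor, of growth
    1, times a Gamma quotient of growth - 1/2; it contributes 1/4. *)
Lemma growth_Acoef (R : realType) (d : nat) : growth ((d - 2)%:R / 4 : R) (Acoef R d).
Proof.
pose F i n : R := Num.sqrt ((2 * n + d - i - 2)%:R * Gamma (n%:R + (d - i - 2)%:R / 2)
                / Gamma (n%:R + (d - i - 1)%:R / 2)).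
rewrite -[_ / 4]add0r; apply: growthM; first exact: growth_const.
apply: (@growth_prod _ _ _ F) => i id2.
have [k [k0 dk]] : exists k, (0 < k)%N /\ d = (i + k + 2)%N.
  by exists (d - 2 - i)%N; lia.
rewrite (_ : 4^-1 = (1 + - 2^-1) / 2 :> R); last by field.
apply: growth_sqrt.
rewrite (_ : (fun _ => _) = (fun n => (2 * n + k)%:R * (Gamma (n%:R + k%:R / 2) / Gamma (n%:R + k.+1%:R / 2)))).
  apply: growthM; last exact: growth_Gamma_ratio.
  apply: (@growth_linear R _ (k%:R / 2)); rewrite ?addr_gt0 ?divr_gt0 ?ltr0n //.
  move=> n; have nk : 0 < n%:R + k%:R / 2 :> R by rewrite ltr_wpDl // divr_gt0 ?ltr0n.
  have e m : (2 * m + k)%:R = 2 * (m%:R + k%:R / 2) :> R by rewrite natrD natrM; field.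
  rewrite !e -[n.+1%:R]natr1 (addrAC _ 1).
  by move: nk; set x := _ + _ => x0; field; rewrite gt_eqF.
have [e2 e1] : (d - i - 2 = k)%N /\ (d - i - 1 = k.+1)%N by lia.
apply/funext => n; have e0 : (2 * n + d - i - 2 = 2 * n + k)%N by lia.
by rewrite e0 e1 e2 mulrA.
Qed.

Lemma growth_dimH (R : realType) (d : nat) : (3 <= d)%N ->
  growth ((d - 2)%:R : R) (dimH R d).
Proof.
move=> d3; have [k dk] : exists k, d = k.+3 by exists (d - 3)%N; lia.
have -> : (d - 2)%:R = 1 + k%:R :> R by rewrite dk !subSS subn0 -natr1 addrC.
rewrite (_ : dimH R d = fun n => ((2 * n + k.+1)%:R / (d - 2)`!%:R) * ((n + k)`!%:R / n`!%:R)).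
  apply: growthM.
    apply: (@growth_linear R _ (k.+1%:R / 2)); rewrite ?addr_gt0 ?divr_gt0 ?ltr0n //.
    move=> n; have nk : 0 < n%:R + k.+1%:R / 2 :> R by rewrite ltr_wpDl // divr_gt0 ?ltr0n.
    rewrite mulrA; congr (_ / _).
    have e m : (2 * m + k.+1)%:R = 2 * (m%:R + k.+1%:R / 2) :> R by rewrite natrD natrM; field.
    rewrite !e -[n.+1%:R]natr1 (addrAC _ 1).
    by move: nk; set x := n%:R + _ => x0; field; rewrite gt_eqF.
  apply: (@growth_linear R _ 1) => // n.
  rewrite addSn !factS !natrM natr1.
  have n0 : 0 < n`!%:R :> R by rewrite ltr0n fact_gt0.
  rewrite -addSn natrD; field.
  by rewrite (gt_eqF n0) addrC natr1 gt_eqF.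
apply/funext => n; rewrite /dimH !natrM invfM mulrACA.
have -> : (2 * n + d - 2 = 2 * n + k.+1)%N by lia.
by have -> : (n + d - 3 = n + k)%N by lia.
Qed.

Lemma growth_coef (R : realType) (d : nat) : (3 <= d)%N ->
  growth (3 * (d - 2)%:R / 4 : R) (fun n => Num.sqrt (dimH R d n) * Acoef R d n).
Proof.
move=> d3; rewrite (_ : _ / 4 = (d - 2)%:R / 2 + (d - 2)%:R / 4); last by field.
apply: growthM; last exact: growth_Acoef.
by apply: growth_sqrt; exact: growth_dimH.
Qed.

(** * Differences of samples of a smooth function *)

Section SmoothDifferences.
Context {R : realType}.
Implicit Types (f g : R -> R) (C h x : R).

(** Naming the derivatives one at a time makes the class stable under
    translation differences without any argument about germs. *)
Fixpoint bounded_deriv (k : nat) C g : Prop :=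
  if k is k'.+1 then
    exists2 g', forall x, 0 < x -> is_derive x 1 g (g' x) & bounded_deriv k' C g'
  else forall x, 0 < x -> `|g x| <= C.

(** A difference of step h trades one derivative for a factor h, by the mean
    value theorem applied to the last but one derivative. *)
Lemma bounded_deriv_translate k C h g : 0 < h -> bounded_deriv k.+1 C g ->
  bounded_deriv k (C * h) (fun x => g (x + h) - g x).
Proof.
move=> h0; elim: k g => [|k IH] g [g' dg bg'].
  move=> x x0.
  have xh : x < x + h by rewrite ltrDl.
  have [||c] := @MVT R g g' x (x + h) xh.
  - by move=> y; rewrite in_itv /= => /andP[xy _]; apply: dg; exact: lt_trans xy.
  - apply: derivable_within_continuous => y; rewrite in_itv /= => /andP[xy _].
    by have [] := dg y (lt_le_trans x0 xy).
  rewrite in_itv /= => /andP[xc _] ->.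
  rewrite addrAC subrr add0r normrM (gtr0_norm h0) ler_wpM2r // ?(ltW h0) //.
  by apply: bg'; exact: lt_trans xc.
exists (fun x => g' (x + h) - g' x); last exact: IH.
move=> x x0; apply: is_deriveB; last exact: dg.
have xh : 0 < x + h by rewrite addr_gt0.
have dh : is_derive x 1 (fun x : R => x + h) 1.
  by apply: is_derive_eq; rewrite addr0.
have := @is_derive1_comp R g (fun x => x + h) x _ _ (dg _ xh) dh.
by rewrite mulr1.
Qed.

Lemma fwd_sample_le k C h g : 0 < h -> bounded_deriv k C g ->
  forall n, (0 < n)%N -> `|iter k fwd (fun n => g (n%:R * h)) n| <= C * h ^+ k.
Proof.
move=> h0; elim: k C g => [|k IH] C g bg n n0.
  by rewrite mulr1 /=; apply: bg; rewrite mulr_gt0 // ltr0n.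
rewrite iterSr exprS mulrA.
rewrite (_ : fwd _ = fun n => g (n%:R * h + h) - g (n%:R * h)).
  exact: (IH _ (fun x => g (x + h) - g x) (bounded_deriv_translate h0 bg)).
by apply/funext => m; rewrite /fwd -natr1 mulrDl mul1r.
Qed.

End SmoothDifferences.

Lemma derive1n_eq0_right (R : realType) (g : R -> R) (T : R) k :
  (forall t, T < t -> g t = 0) -> forall t, T < t -> derive1n k g t = 0.
Proof.
move=> g0; elim: k => [//|k IH] t Tt.
rewrite derive1nS derive1E (@near_eq_derive _ _ _ _ (cst 0)) ?derive_cst //.
near=> y; rewrite IH //; near: y; exact: lt_nbhsr.
Unshelve. all: by end_near. Qed.

(** Near 0 the derivative converges, on a compact segment it is continuous, and
    beyond T it vanishes. *)
Lemma Cq_halfline_bounded (R : realType) (q k : nat) (g : R -> R) (T : R) :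
  Cq_halfline q g -> (forall t, T < t -> g t = 0) -> (k <= q)%N ->
  exists C, forall t, 0 < t -> `|derive1n k g t| <= C.
Proof.
move=> [_ dg cg lg] gT kq; set F := derive1n k g.
have cF t : 0 < t -> {for t, continuous F}.
  move=> t0; move: kq; rewrite leq_eqVlt => /predU1P[kq|kq].
    by rewrite /F kq; exact: cg.
  by apply: differentiable_continuous; apply/derivable1_diffP; exact: dg.
have /cvgrPdist_lt /(_ 1 ltr01) [e /= e0 He] := lg k kq.
pose a := Num.min (e / 2) 1; pose b := Num.max 2 T.
have a0 : 0 < a by rewrite lt_min divr_gt0 //= ltr01.
have ab : a <= b by rewrite ge_min; apply/orP; right; rewrite le_max ler1n.
have cFab : {within `[a, b], continuous (fun t => `|F t|)}.
  apply: continuous_in_subspaceT => t; rewrite inE /= in_itv /= => /andP[at_ _].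
  apply: continuous_comp; last exact: norm_continuous.
  by apply: cF; exact: lt_le_trans at_.
have [c _ Fc] := EVT_max ab cFab.
pose L := lim (F t @[t --> 0^'+]).
exists (Num.max (`|L| + 1) `|F c|) => t t0; rewrite le_max.
have [ta|ta] := ltP t a.
  apply/orP; left.
  have /He : ball 0 e t.
    rewrite /ball /= sub0r normrN gtr0_norm //.
    by move: ta; rewrite lt_min => /andP[h _]; apply: (lt_trans h); lra.
  move=> /(_ t0) /= h.
  have := ler_normD (F t - L) L; rewrite subrK => h2.
  by apply: (le_trans h2); rewrite addrC lerD2l distrC ltW.
have [tb|tb] := leP t b.
  by apply/orP; right; apply: Fc; rewrite in_itv /= ta.
rewrite /F (derive1n_eq0_right _ gT) ?normr0 ?addr_ge0 //.
by move: tb; rewrite gt_max => /andP[].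
Qed.

Lemma Cq_halfline_bounded_deriv (R : realType) (q k : nat) (g : R -> R) (T : R) :
  Cq_halfline q g -> (forall t, T < t -> g t = 0) -> (k <= q)%N ->
  exists C, bounded_deriv k C g.
Proof.
move=> Cg gT kq; have [C gC] := Cq_halfline_bounded Cg gT kq; exists C.
have [_ dg _ _] := Cg.
suff H m i : (i + m)%N = k -> bounded_deriv m C (derive1n i g) by exact: (H k 0%N).
elim: m i => [|m IH] i im; first by move: gC; rewrite -im addn0.
exists (derive1n i.+1 g); last by apply: IH; rewrite addSnnS.
move=> x x0; apply: DeriveDef; last by rewrite derive1nS derive1E.
apply: dg => //; apply: leq_trans kq; rewrite -im; lia.
Qed.

Lemma kappa_eq0_left (R : realType) (phi : R -> R) t :
  (forall t, 0 <= t <= 1 / 2 -> phi t = 1) -> 0 <= t <= 1 / 2 -> kappa phi t = 0.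
Proof.
move=> phi1 ht; rewrite /kappa !phi1 ?subrr ?sqrtr0 //.
by case/andP: ht => h1 h2; apply/andP; split; lra.
Qed.

Lemma kappa_eq0_right (R : realType) (phi : R -> R) t :
  (forall t, 1 <= t -> phi t = 0) -> 2 <= t -> kappa phi t = 0.
Proof. by move=> phi0 ht; rewrite /kappa !phi0 ?subrr ?sqrtr0 //; lra. Qed.

(** * Differences of windowed sequences *)

Section Leibniz.
Context {R : realType}.
Implicit Types (u v f g b : nat -> R).

Lemma iter_fwdD k u v n :
  iter k fwd (fun n => u n + v n) n = iter k fwd u n + iter k fwd v n.
Proof.
elim: k u v => [//|k IH] u v; rewrite !iterSr -IH; congr (iter _ _ _ _).
by apply/funext => m; rewrite /fwd; ring.
Qed.

Lemma iter_fwd_shift k u n : iter k fwd (fun n => u n.+1) n = iter k fwd u n.+1.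
Proof. by elim: k u => [//|k IH] u; rewrite !iterSr -IH. Qed.

Lemma iter_fwd_eq0 k u n :
  (forall m, (n <= m <= n + k)%N -> u m = 0) -> iter k fwd u n = 0.
Proof.
elim: k u => [|k IH] u u0; first by apply: u0; lia.
by rewrite iterSr; apply: IH => m hm; rewrite /fwd !u0 ?subrr //; lia.
Qed.

(** The Leibniz rule in the form of an estimate: if both factors gain h at each
    difference, so does the product. The k-th difference at n only involves
    the indices from n to n + k, which is why the hypotheses are restricted to
    that range. *)
Lemma iter_fwdM_le k u v (U V h : R) n : 0 <= h ->
  (forall i m, (n <= m)%N -> (m + i <= n + k)%N -> `|iter i fwd u m| <= U * h ^+ i) ->
  (forall i m, (n <= m)%N -> (m + i <= n + k)%N -> `|iter i fwd v m| <= V * h ^+ i) ->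
  `|iter k fwd (fun n => u n * v n) n| <= 2 ^+ k * (U * V * h ^+ k).
Proof.
move=> h0; elim: k u v U V n => [|k IH] u v U V n uU vV.
  rewrite /= mul1r mulr1 normrM.
  have := uU 0%N n (leqnn _) (leqnn _); have := vV 0%N n (leqnn _) (leqnn _).
  by rewrite !mulr1 /= => h1 h2; rewrite ler_pM.
rewrite iterSr (_ : fwd _ = fun n => fwd u n * v n.+1 + u n * fwd v n); last first.
  by apply/funext => m; rewrite /fwd; ring.
rewrite iter_fwdD (le_trans (ler_normD _ _)) //.
have h1 : `|iter k fwd (fun n => fwd u n * v n.+1) n| <= 2 ^+ k * (U * h * V * h ^+ k).
  apply: (IH _ (fun n => v n.+1)) => i m nm mi.
    by rewrite -iterSr -mulrA -exprS; apply: uU; lia.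
  by rewrite iter_fwd_shift; apply: vV; lia.
have h2 : `|iter k fwd (fun n => u n * fwd v n) n| <= 2 ^+ k * (U * (V * h) * h ^+ k).
  apply: IH => i m nm mi; first by apply: uU; lia.
  by rewrite -iterSr -mulrA -exprS; apply: vV; lia.
by rewrite (le_trans (lerD h1 h2)) // !exprS le_eqVlt; apply/orP; left; apply/eqP; ring.
Qed.

Lemma uniform_bound k (Q : nat -> R -> Prop) :
  (forall i C C', Q i C -> C <= C' -> Q i C') ->
  (forall i, (i <= k)%N -> exists2 C, 0 <= C & Q i C) ->
  exists2 C, 0 <= C & forall i, (i <= k)%N -> Q i C.
Proof.
move=> Qle; elim: k => [|k IH] H.
  by have [C C0 QC] := H 0%N isT; exists C => // i; rewrite leqn0 => /eqP ->.
have [C C0 QC] := IH (fun i ik => H i (leqW ik)).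
have [D D0 QD] := H k.+1 (leqnn _).
exists (C + D); first exact: addr_ge0.
move=> i; rewrite leq_eqVlt => /predU1P[->|ik].
  by apply: Qle QD _; rewrite lerDr.
by apply: Qle (QC i ik) _; rewrite lerDl.
Qed.

(** Where the window is not identically 0 on [n, n + k], the index n is
    comparable to N up to constants depending on k, so that the bounds in powers
    of n + 1 for b become bounds in powers of N. The condition 2 k <= N keeps
    n > 0 there, so that g is sampled in (0, oo) only. *)
Lemma fwd_window_le k b (e : R) (g : R -> R) : 0 <= e -> growth e b ->
  (forall i, (i <= k)%N -> exists C, bounded_deriv i C g) ->
  (forall t, 0 <= t <= 1 / 2 -> g t = 0) -> (forall t, 2 <= t -> g t = 0) ->
  exists2 C, 0 <= C & forall N n, (0 < N)%N -> (2 * k <= N)%N ->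
    `|iter k fwd (fun n => b n * g (n%:R / N%:R)) n| <= C * (N%:R `^ e / N%:R ^+ k).
Proof.
move=> e0 gb gd gl gr.
have [Cb Cb0 hb] := growth_le e0 gb.
have [Cd Cd0 hd] : exists2 C : R, 0 <= C & forall i, (i <= k)%N ->
    forall n, `|iter i fwd b n| * n.+1%:R ^+ i <= C * `|b n|.
  apply: uniform_bound => [i C C' H CC' n|i _]; last exact: growth_fwd gb.
  by apply: (le_trans (H n)); rewrite ler_wpM2r.
have [Cg Cg0 hg] : exists2 C : R, 0 <= C & forall i, (i <= k)%N ->
    forall N n, (0 < N)%N -> (0 < n)%N ->
      `|iter i fwd (fun n => g (n%:R / N%:R)) n| <= C * N%:R^-1 ^+ i.
  apply: uniform_bound => [i C C' H CC' N n N0 n0|i ik].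
    by apply: (le_trans (H N n N0 n0)); rewrite ler_wpM2r // exprn_ge0 // invr_ge0.
  have [C HC] := gd i ik.
  have H N n : (0 < N)%N -> (0 < n)%N ->
      `|iter i fwd (fun n => g (n%:R / N%:R)) n| <= C * N%:R^-1 ^+ i.
    by move=> N0 n0; apply: (fwd_sample_le _ HC) => //; rewrite invr_gt0 ltr0n.
  exists C => //.
  have := H 1%N 1%N isT isT; rewrite invr1 expr1n mulr1; exact: le_trans.
exists (2 ^+ k * (Cd * Cb * 3 `^ e * Cg * (2 * k.+1%:R) ^+ k)).
  by rewrite !mulr_ge0 ?exprn_ge0 ?powR_ge0 // mulr_ge0.
move=> N n N0 kN.
have N0' : 0 < N%:R :> R by rewrite ltr0n.
set f := fun n => _.
have Cpos : 0 <= 2 ^+ k * (Cd * Cb * 3 `^ e * Cg * (2 * k.+1%:R) ^+ k) * (N%:R `^ e / N%:R ^+ k).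
  by rewrite !mulr_ge0 ?invr_ge0 ?exprn_ge0 ?powR_ge0 // mulr_ge0.
have [nl|nl] := leqP (2 * (n + k)) N.
  rewrite iter_fwd_eq0 ?normr0 // => m hm; rewrite /f gl ?mulr0 //.
  rewrite divr_ge0 //= ler_pdivrMr // mulrC mulrA mulr1 ler_pdivlMr // -natrM ler_nat.
  by lia.
have [nr|nr] := leqP (2 * N) n.
  rewrite iter_fwd_eq0 ?normr0 // => m hm; rewrite /f gr ?mulr0 //.
  by rewrite ler_pdivlMr // -natrM ler_nat; lia.
have n0 : (0 < n)%N by lia.
(* h bounds both the gain 1 / (m + 1) of b and the gain 1 / N of g. *)
have [h hE] : exists h : R, h = 2 * k.+1%:R / N%:R by eexists.
have h0 : 0 <= h by rewrite hE divr_ge0 // mulr_ge0.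
have -> : 2 ^+ k * (Cd * Cb * 3 `^ e * Cg * (2 * k.+1%:R) ^+ k) * (N%:R `^ e / N%:R ^+ k) =
    2 ^+ k * ((Cd * Cb * (3 `^ e * N%:R `^ e)) * Cg * h ^+ k).
  by rewrite hE expr_div_n; ring.
apply: iter_fwdM_le => // i m nm mi.
- have ik : (i <= k)%N by lia.
  have m0 : 0 < m.+1%:R :> R by [].
  rewrite -(ler_pM2r (exprn_gt0 i m0)).
  apply: (le_trans (hd i ik m)).
  have -> : Cd * Cb * (3 `^ e * N%:R `^ e) * h ^+ i * m.+1%:R ^+ i =
    Cd * (Cb * ((3 `^ e * N%:R `^ e) * (h * m.+1%:R) ^+ i)) by rewrite exprMn !mulrA.
  rewrite ler_wpM2l // (le_trans (hb m)) // ler_wpM2l //.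
  rewrite -powRM // -[leLHS]mulr1 ler_pM ?powR_ge0 //.
    rewrite ge0_ler_powR ?nnegrE ?mulr_ge0 //.
    by rewrite -natrM ler_nat; lia.
  rewrite exprn_ege1 // hE mulrAC ler_pdivlMr // mul1r -!natrM ler_nat; nia.
- have ik : (i <= k)%N by lia.
  apply: (le_trans (hg i ik N m N0 _)); first by lia.
  rewrite ler_wpM2l // lerXn2r ?nnegrE ?invr_ge0 //.
  by rewrite hE ler_pdivlMr // mulVf ?gt_eqF // -natrM ler1n.
Qed.

End Leibniz.

(** * Power series and the principal argument in the unit disc *)

(** The derivative of sin t - t cos t is t sin t >= 0. *)
Lemma mul_cos_le_sin (R : realType) (t : R) : 0 <= t <= pi -> t * cos t <= sin t.
Proof.
case/andP=> t0 tpi; have [->|tn0] := eqVneq t 0; first by rewrite mul0r sin0.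
have {}t0 : 0 < t by rewrite lt_neqAle eq_sym tn0.
pose f (x : R) : R := sin x - x * cos x.
have df (x : R) : is_derive x 1 f (x * sin x).
  have dx : is_derive x 1 (fun y : R => y * cos y) (x *: (- sin x) + cos x *: 1).
    exact: (is_deriveM (is_derive_id x 1) (is_derive_cos x)).
  apply: is_derive_eq; rewrite /GRing.scale /=; ring.
have cf : {within `[0, t], continuous f}.
  by apply: derivable_within_continuous => x _; have [] := df x.
have [c] := MVT t0 (fun x _ => df x) cf.
rewrite in_itv /= => /andP[c0 ct] e.
have f0 : f 0 = 0 by rewrite /f sin0 mul0r subrr.
move: e; rewrite f0 !subr0 => e; rewrite -subr_ge0 -[X in 0 <= X]/(f t) e.
rewrite mulr_ge0 // ?(ltW t0) // mulr_ge0 ?(ltW c0) //.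
by rewrite sin_ge0_pi // (ltW c0) (le_trans (ltW ct)).
Qed.

Section Complex.
Context {R : realType}.
Implicit Types (f : nat -> R) (z w : R[i]).
Local Open Scope complex_scope.

Lemma cmod_ge0 z : 0 <= cmod z.
Proof. by case: z => a b; exact: sqrtr_ge0. Qed.

(** For z = r exp (i t), |1 - z|^2 = 1 - 2 r cos t + r^2. If cos t <= 1/2 this
    is at least 3/4, while |t| <= pi < 4. If cos t > 1/2 it is at least
    (sin t)^2, and sin |t| >= |t| cos t >= |t| / 2. *)
Lemma Arg_le_dist1 z : cmod z <= 1 -> `|Arg z| / 8 <= cmod (1 - z).
Proof.
(* If no polar form existed, Arg z would be the default value 0. *)
move=> z1; rewrite /Arg; case: xgetP => [t _ [/andP[tpi1 tpi2] zE]|_]; last first.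
  by rewrite normr0 mul0r cmod_ge0.
move: (cmod_ge0 z) z1 zE; move: (cmod z) => r r0 r1 ->.
have -> : cmod (1 - r%:C * (cos t +i* sin t)) =
    Num.sqrt ((1 - r * cos t) ^+ 2 + (r * sin t) ^+ 2).
  rewrite /=; congr (Num.sqrt (_ ^+ 2 + _)); first by ring.
  by rewrite -sqrrN; congr (_ ^+ 2); ring.
rewrite -[leLHS]ger0_norm; last by rewrite divr_ge0.
rewrite -sqrtr_sqr ler_wsqrtr //.
have tpi : `|t| <= pi by rewrite ler_norml (ltW tpi1).
have pi4 : pi < 4 :> R by have := @pihalf_lt2 R; rewrite ltr_pdivrMr //; lra.
have sc : cos t ^+ 2 + sin t ^+ 2 = 1 := cos2Dsin2 t.
have t16 : `|t| ^+ 2 <= 16.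
  have -> : 16 = 4 ^+ 2 :> R by ring.
  by rewrite lerXn2r ?nnegrE // (le_trans tpi) // ltW.
have -> : (1 - r * cos t) ^+ 2 + (r * sin t) ^+ 2 = 1 - 2 * (r * cos t) + r ^+ 2.
  have -> : (1 - r * cos t) ^+ 2 + (r * sin t) ^+ 2 =
     1 - 2 * (r * cos t) + r ^+ 2 * (cos t ^+ 2 + sin t ^+ 2) by ring.
  by rewrite sc mulr1.
rewrite exprMn; have [c2|c2] := leP (cos t) (1 / 2).
  have h : r * cos t <= r * (1 / 2) by rewrite ler_wpM2l.
  have := sqr_ge0 (r - 1 / 2); rewrite !expr2 in t16 *; nra.
have cosn : cos `|t| = cos t.
  by have [|] := leP 0 t => ?; [rewrite ger0_norm | rewrite ltr0_norm // cosN].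
have sinn : sin `|t| ^+ 2 = sin t ^+ 2.
  by have [|] := leP 0 t => ?; [rewrite ger0_norm | rewrite ltr0_norm // sinN sqrrN].
have h : `|t| * (1 / 2) <= sin `|t|.
  apply: le_trans (mul_cos_le_sin _); last by rewrite normr_ge0.
  by rewrite cosn ler_wpM2l // ltW.
have {}h : (`|t| * (1 / 2)) ^+ 2 <= sin `|t| ^+ 2.
  by rewrite lerXn2r ?nnegrE ?(le_trans _ h) // mulr_ge0 //; lra.
rewrite sinn in h.
have := sqr_ge0 (r - cos t); have := sqr_ge0 `|t|; rewrite !expr2 in h sc *; nra.
Qed.

Lemma cmodX z n : cmod (z ^+ n) = cmod z ^+ n.
Proof.
elim: n => [|n IH]; first by rewrite !expr0 ComplexField.Normc.normc1.
by rewrite !exprS ComplexField.Normc.normcM IH.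
Qed.

Lemma cmod_real (x : R) : cmod (x%:C : R[i]) = `|x|.
Proof. by rewrite /= expr0n /= addr0 sqrtr_sqr. Qed.

Lemma cmod_sum (I : Type) (r : seq I) (F : I -> R[i]) :
  cmod (\sum_(i <- r) F i) <= \sum_(i <- r) cmod (F i).
Proof.
elim: r => [|i r IH]; first by rewrite !big_nil ComplexField.Normc.normc0.
by rewrite !big_cons (le_trans (le_normcD _ _)) // lerD2l.
Qed.

Lemma Re_le_cmod z : `|complex.Re z| <= cmod z.
Proof.
case: z => a b /=; rewrite -sqrtr_sqr ler_wsqrtr // lerDl; exact: sqr_ge0.
Qed.

Lemma summation_by_parts1 f z M :
  (1 - z) * \sum_(n < M) (f n)%:C * z ^+ n =
  z * \sum_(n < M) (fwd f n)%:C * z ^+ n + (f 0%N)%:C - (f M)%:C * z ^+ M.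
Proof.
elim: M => [|M IH]; first by rewrite !big_ord0 !mulr0 add0r mulr1 subrr.
rewrite !big_ord_recr /= !mulrDr IH /fwd rmorphB /= exprS; ring.
Qed.

(** The vanishing of f below k and beyond M kills all boundary terms. *)
Lemma summation_by_parts k f z M : (forall n, (n < k)%N -> f n = 0) ->
  (forall n, (M <= n)%N -> f n = 0) ->
  (1 - z) ^+ k * \sum_(n < M) (f n)%:C * z ^+ n =
  z ^+ k * \sum_(n < M) (iter k fwd f n)%:C * z ^+ n.
Proof.
elim: k f => [//|k IH] f f0 fM.
rewrite exprSr -mulrA summation_by_parts1 f0 // (fM M) //.
rewrite mul0r subr0 addr0 mulrCA IH => [|n nk|n Mn].
- by rewrite mulrA -exprS; under [in RHS]eq_bigr do rewrite iterSr.
- by rewrite /fwd !f0 ?subrr // ltnS ltnW.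
- by rewrite /fwd !fM ?subrr // leqW.
Qed.

End Complex.

(** * Localization of windowed polynomials and of curvelets *)

Section Localization.
Context {R : realType}.
Implicit Types (g : R -> R) (z : R[i]).
Local Open Scope complex_scope.

Lemma powR_le_exp (r t : R) m : 0 <= r -> r <= 1 -> 0 < t -> t <= m%:R ->
  r ^+ m <= r `^ t.
Proof.
move=> r0 r1 t0 tm; rewrite -powR_mulrn //.
have [->|rn0] := eqVneq r 0; first by rewrite !powR0 ?gt_eqF // (lt_le_trans t0).
by rewrite ger_powR // lt_neqAle eq_sym rn0 r0.
Qed.

Lemma window_poly_le k (b : nat -> R) (e : R) g : 0 <= e -> growth e b ->
  (forall i, (i <= k)%N -> exists C, bounded_deriv i C g) ->
  (forall t, 0 <= t <= 1 / 2 -> g t = 0) -> (forall t, 2 <= t -> g t = 0) ->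
  exists2 C, 0 <= C & forall N z, (0 < N)%N -> (2 * k <= N)%N -> cmod z <= 1 ->
    cmod (1 - z) ^+ k * cmod (\sum_(n < 2 * N) (b n * g (n%:R / N%:R))%:C * z ^+ n)
      <= C * (N%:R `^ (e + 1) / N%:R ^+ k) * cmod z `^ (N%:R / 2).
Proof.
move=> e0 gb gd gl gr; have [C C0 HC] := fwd_window_le e0 gb gd gl gr.
exists (2 * C); first by rewrite mulr_ge0.
move=> N z N0 kN z1; have N0' : 0 < N%:R :> R by rewrite ltr0n.
pose f n := b n * g (n%:R / N%:R).
have fl n : (2 * n <= N)%N -> f n = 0.
  move=> nN; rewrite /f gl ?mulr0 // divr_ge0 //= ler_pdivrMr // mulrC mulrA mulr1.
  by rewrite ler_pdivlMr // -natrM ler_nat mulnC.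
have fr n : (2 * N <= n)%N -> f n = 0.
  by move=> nN; rewrite /f gr ?mulr0 // ler_pdivlMr // -natrM ler_nat.
rewrite -cmodX -ComplexField.Normc.normcM (summation_by_parts (f := f)) //; last first.
  by move=> n nk; apply: fl; lia.
rewrite ComplexField.Normc.normcM cmodX.
apply: (@le_trans _ _ (\sum_(n < 2 * N) C * (N%:R `^ e / N%:R ^+ k) * cmod z `^ (N%:R / 2))).
  apply: (@le_trans _ _ (cmod z ^+ k * \sum_(n < 2 * N) cmod ((iter k fwd f n)%:C * z ^+ n))).
    by rewrite ler_wpM2l ?exprn_ge0 ?cmod_ge0 //; exact: cmod_sum.
  rewrite mulr_sumr; apply: ler_sum => n _.
  rewrite ComplexField.Normc.normcM cmod_real cmodX mulrCA -exprD.
  have [nl|nl] := leqP (2 * (n + k)) N.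
    rewrite iter_fwd_eq0 ?normr0 ?mul0r; last by move=> m hm; apply: fl; lia.
    by rewrite !mulr_ge0 ?invr_ge0 ?exprn_ge0 ?powR_ge0 // ltW.
  apply: ler_pM => //; first by rewrite exprn_ge0 // cmod_ge0.
    exact: HC.
  apply: powR_le_exp => //; rewrite ?cmod_ge0 ?divr_gt0 //.
  rewrite ler_pdivrMr // -natrM ler_nat; lia.
rewrite sumr_const card_ord -[leLHS]mulr_natl le_eqVlt; apply/orP; left; apply/eqP.
rewrite powRD; last by rewrite (gt_eqF N0') implybT.
rewrite powRr1 ?(ltW N0') //.
by rewrite natrM; ring.
Qed.

Lemma one_plus_exp_le (y : R) k : 0 <= y -> (1 + y) ^+ k <= 2 ^+ k * (1 + y ^+ k).
Proof.
move=> y0; have [y1|y1] := leP y 1.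
  apply: (@le_trans _ _ (2 ^+ k)); first by rewrite lerXn2r ?nnegrE ?addr_ge0 //; lra.
  by rewrite ler_peMr ?exprn_ge0 // lerDl exprn_ge0.
apply: (@le_trans _ _ ((2 * y) ^+ k)).
  by rewrite lerXn2r ?nnegrE ?addr_ge0 ?mulr_ge0 //; lra.
by rewrite exprMn ler_wpM2l ?exprn_ge0 // lerDr.
Qed.

(** If 2 q <= N, the q-th power of N |Arg z| <= 8 N |1 - z| is absorbed by the
    gain N^(- q) of [window_poly_le]. Otherwise 1 + 2 N |Arg z| <= 1 + 64 q,
    because |Arg z| <= 8 |1 - z| <= 16. *)
Lemma window_poly_localized q (b : nat -> R) (e : R) g : 0 <= e -> growth e b ->
  (forall i, (i <= q)%N -> exists C, bounded_deriv i C g) ->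
  (forall t, 0 <= t <= 1 / 2 -> g t = 0) -> (forall t, 2 <= t -> g t = 0) ->
  exists2 C, 0 <= C & forall N z, (0 < N)%N -> cmod z <= 1 ->
    cmod (\sum_(n < 2 * N) (b n * g (n%:R / N%:R))%:C * z ^+ n)
        * (1 + 2 * N%:R * `|Arg z|) ^+ q
      <= C * N%:R `^ (e + 1) * cmod z `^ (N%:R / 2).
Proof.
move=> e0 gb gd gl gr.
have gd0 i : (i <= 0)%N -> exists C, bounded_deriv i C g.
  by rewrite leqn0 => /eqP ->; exact: gd.
have [C C0 HC] := window_poly_le e0 gb gd0 gl gr.
have [D D0 HD] := window_poly_le e0 gb gd gl gr.
pose K1 := 2 ^+ q * (C + 16 ^+ q * D); pose K2 := C * (1 + 64 * q%:R) ^+ q.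
have K10 : 0 <= K1 by rewrite mulr_ge0 ?exprn_ge0 // addr_ge0 // mulr_ge0 // exprn_ge0.
have K20 : 0 <= K2 by rewrite mulr_ge0 // exprn_ge0 // addr_ge0 // mulr_ge0.
exists (K1 + K2) => [|N z N0 z1]; first exact: addr_ge0.
have N0' : 0 < N%:R :> R by rewrite ltr0n.
have := HC N z N0 isT z1; have := HD N z N0 ^~ z1.
set X := cmod (\sum_(n < _) _); set A := N%:R `^ _; set r := cmod z `^ _.
have X0 : 0 <= X by exact: cmod_ge0.
have A0 : 0 <= A by exact: powR_ge0.
have r0 : 0 <= r by exact: powR_ge0.
have Ar0 : 0 <= A * r by rewrite mulr_ge0.
rewrite !expr0 mul1r divr1 => hD hC.
have hA : `|Arg z| <= 8 * cmod (1 - z).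
  by have := Arg_le_dist1 z1; rewrite ler_pdivrMr // mulrC.
rewrite -[leRHS]mulrA.
have [qN|qN] := leqP (2 * q) N.
  apply: (@le_trans _ _ (K1 * (A * r))); last by rewrite ler_wpM2r // lerDl.
  have y0 : 0 <= 2 * N%:R * `|Arg z| by rewrite !mulr_ge0.
  apply: (le_trans (ler_wpM2l X0 (one_plus_exp_le q y0))).
  rewrite mulrCA -[K1 * _]mulrA ler_wpM2l ?exprn_ge0 //.
  rewrite [leLHS]mulrDr mulr1 [leRHS]mulrDl lerD //; first by rewrite mulrA.
  apply: (@le_trans _ _ (X * (16 * N%:R * cmod (1 - z)) ^+ q)).
    rewrite ler_wpM2l // lerXn2r ?nnegrE ?mulr_ge0 ?cmod_ge0 //.
    have -> : 16 * N%:R * cmod (1 - z) = 2 * N%:R * (8 * cmod (1 - z)) by ring.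
    by rewrite ler_wpM2l // mulr_ge0.
  rewrite !exprMn.
  have -> : X * (16 ^+ q * N%:R ^+ q * cmod (1 - z) ^+ q) =
    16 ^+ q * N%:R ^+ q * (cmod (1 - z) ^+ q * X) by ring.
  apply: (le_trans (ler_wpM2l _ (hD qN))).
    by rewrite mulr_ge0 // exprn_ge0 // ltW.
  rewrite le_eqVlt; apply/orP; left; apply/eqP; field.
  by rewrite expf_neq0 // gt_eqF.
apply: (@le_trans _ _ (K2 * (A * r))); last by rewrite ler_wpM2r // lerDr.
have -> : K2 * (A * r) = (C * A * r) * (1 + 64 * q%:R) ^+ q by rewrite /K2; ring.
rewrite ler_pM // ?exprn_ge0 ?addr_ge0 ?mulr_ge0 //.
have c2 : cmod (1 - z) <= 2.
  apply: (le_trans (le_normcD _ _)); rewrite ComplexField.Normc.normc1 normcN.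
  by move: z1; lra.
rewrite lerXn2r ?nnegrE ?addr_ge0 ?mulr_ge0 // lerD2l.
have Nq : N%:R <= 2 * q%:R :> R by rewrite -natrM ler_nat ltnW.
apply: (@le_trans _ _ (2 * (2 * q%:R) * (8 * 2))); last by lra.
rewrite ler_pM // ?mulr_ge0 // ?ler_wpM2l //.
by apply: (le_trans hA); rewrite ler_wpM2l.
Qed.

Lemma cmod_zcoord_le1 d (x : 'rV[R]_d) : (3 <= d)%N -> on_sphere x ->
  cmod (zcoord x) <= 1.
Proof.
move=> d3 xS; have h1 : (d - 1 < d)%N by lia.
have h2 : (d - 2 < d)%N by lia.
have coordE k (hk : (k < d)%N) : Defs.coord x k = x 0 (Ordinal hk).
  rewrite /Defs.coord; case: insubP => [i _ ik|]; last by rewrite hk.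
  by congr (x 0 _); exact: val_inj.
rewrite /zcoord (coordE _ h1) (coordE _ h2) /= -[leRHS]sqrtr1 ler_wsqrtr //.
rewrite -xS (bigD1 (Ordinal h1)) //= (bigD1 (Ordinal h2)) /=; last first.
  by rewrite -val_eqE /=; lia.
by rewrite addrA lerDl sumr_ge0 // => i _; exact: sqr_ge0.
Qed.

Lemma limn_series_finite (u : nat -> R) M : (forall n, (M <= n)%N -> u n = 0) ->
  limn (series u) = \sum_(n < M) u n.
Proof.
move=> uM; apply: cvg_lim => //; apply: cvg_near_cst; near=> n.
have Mn : (M <= n)%N by near: n; exact: nbhs_infty_ge.
rewrite /series /= -(big_mkord xpredT u) (big_cat_nat (n := M)) //=.
by rewrite [X in _ + X]big_nat_cond [X in _ + X]big1 ?addr0 // => i /andP[/andP[/uM]].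
Unshelve. all: by end_near. Qed.

Lemma curveletE d phi j (x : 'rV[R]_d) : (forall t : R, 1 <= t -> phi t = 0) ->
  curvelet phi j.+1 x = Num.sqrt 2 * complex.Re (\sum_(n < 2 * 2 ^ j)
    (Num.sqrt (dimH R d n) * Acoef R d n * kappa phi (n%:R / (2 ^ j)%:R))%:C * zcoord x ^+ n).
Proof.
move=> phi0; rewrite /curvelet (@limn_series_finite _ (2 * 2 ^ j)); last first.
  move=> n nj; rewrite kappa_eq0_right // ?(mulr0, mul0r) //.
  by rewrite ler_pdivlMr ?exprn_gt0 // -natrX -natrM ler_nat.
congr (_ * _); rewrite raddf_sum; apply: eq_bigr => n _.
rewrite natrX; case: (zcoord x ^+ n) => a b /=; ring.
Qed.

End Localization.

(** * The localization bound *)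

Theorem theorem4p1 (R : realType) (d q : nat) (phi : R -> R)
  (hd : (3 <= d)%N) (hq : (1 <= q)%N)
  (phi_Cq : Cq_halfline q phi)
  (phi_noninc : forall s t : R, 0 <= s -> s <= t -> phi t <= phi s)
  (phi_one : forall t : R, 0 <= t <= 1 / 2 -> phi t = 1)
  (phi_zero : forall t : R, 1 <= t -> phi t = 0)
  (kappa_Cq : Cq_halfline q (kappa phi))
  (kappa_deriv : exists t0 : R, 1 / 2 < t0 < 2 /\
     forall t : R, 1 / 2 < t < t0 -> derive1n q (kappa phi) t <> 0) :
  exists c : R, 0 < c /\
    forall (j : nat) (x : 'rV[R]_d), (1 <= j)%N -> on_sphere x ->
      `|curvelet phi j x| <=
      c * 2 `^ (j%:R * (3 * d%:R - 2) / 4)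
        * cmod (zcoord x) `^ (2 `^ (j%:R - 2))
      / (1 + 2 ^+ j * `|Arg (zcoord x)|) ^+ q.
Proof.
have kl t : 0 <= t <= 1 / 2 -> kappa phi t = 0 by exact: kappa_eq0_left.
have kr t : 2 <= t -> kappa phi t = 0 by exact: kappa_eq0_right.
have kd i : (i <= q)%N -> exists C, bounded_deriv i C (kappa phi).
  by apply: Cq_halfline_bounded_deriv => // t /ltW; exact: kr.
pose e : R := 3 * (d - 2)%:R / 4.
have e0 : 0 <= e by rewrite divr_ge0 // mulr_ge0.
have [C C0 HC] := window_poly_localized e0 (growth_coef R hd) kd kl kr.
exists (Num.sqrt 2 * C + 1); split; first by rewrite ltr_wpDl // mulr_ge0 ?sqrtr_ge0.
move=> [//|j] x _ xS; set z := zcoord x.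
have T0 : 0 < (1 + 2 ^+ j.+1 * `|Arg z|) ^+ q.
  by rewrite exprn_gt0 // ltr_pwDl // mulr_ge0 // exprn_ge0.
rewrite ler_pdivlMr // curveletE // normrM ger0_norm ?sqrtr_ge0 //.
set P := \sum_(n < _) _.
have z1 : cmod z <= 1 by exact: cmod_zcoord_le1.
have := HC (2 ^ j)%N z (expn_gt0 2 j) z1; rewrite -/P natrX -exprS.
have -> : 2 ^+ j / 2 = 2 `^ (j.+1%:R - 2) :> R.
  have -> : j.+1%:R - 2 = j%:R - 1 :> R by rewrite -natr1; ring.
  rewrite powRB; last by rewrite pnatr_eq0 implybT.
  by rewrite powR_mulrn // powRr1.
set rho := cmod z `^ _ => hP.
have rho0 : 0 <= rho by exact: powR_ge0.
have hN : (2 ^+ j) `^ (e + 1) <= 2 `^ (j.+1%:R * (3 * d%:R - 2) / 4) :> R.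
  rewrite -powR_mulrn // -powRrM ler_powR ?ler1n //.
  have -> : e + 1 = (3 * d%:R - 2) / 4.
    by rewrite /e natrB; [field | lia].
  rewrite mulrA ler_wpM2r // ler_wpM2r ?ler_nat //.
  have : 3 <= d%:R :> R by rewrite ler_nat.
  by lra.
rewrite -mulrA.
apply: (@le_trans _ _ (Num.sqrt 2 * (C * (2 ^+ j) `^ (e + 1) * rho))).
  rewrite -[leLHS]mulrA ler_wpM2l ?sqrtr_ge0 //; apply: le_trans hP.
  by rewrite ler_wpM2r ?(ltW T0) // Re_le_cmod.
rewrite -[C * _ * _]mulrA [leLHS]mulrA.
rewrite ler_pM ?mulr_ge0 ?sqrtr_ge0 ?powR_ge0 //; first by rewrite lerDl.
by rewrite ler_wpM2r.
Qed.
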